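(* Let $f$ be a polynomial of degree $D\ge2$ with disconnected Julia set $J(f)$. If $z\in J(f)$ is a periodic point of $f$ such that $\{z\}$ is a connected component of $J(f)$, then $z$ is repelling, i.e. $|(f^n)'(z)|>1$ where $n$ is the period of $z$.
   Context: $J(f)=\partial K(f)$ where $K(f)=\{z\in\mathbb{C}:\sup_n|f^n(z)|<\infty\}$. *)

(* Defs.v *)
From HB Require Import structures.
From mathcomp Require Import all_boot all_order all_algebra.
From mathcomp Require Import all_classical all_reals all_analysis.
From mathcomp.real_closed Require Import complex.

Set Implicit Arguments.
Unset Strict Implicit.
Unset Printing Implicit Defensive.

Import Order.TTheory GRing.Theory Num.Theory.
Import numFieldNormedType.Exports.

Local Open Scope classical_set_scope.
Local Open Scope ring_scope.

(* The usual topology of the complex plane: R[i] as a one-dimensional normed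
   module over itself, so that [derive1] on it is the complex derivative. The
   norm is R[i]-valued, with values in the nonnegative reals. *)
#[non_forgetful_inheritance]
HB.instance Definition _ (R : realType) := NormedModule.copy R[i] R[i]^o.

Definition filled_julia (R : realType) (f : {poly R[i]}) : set R[i] :=
  [set z | bounded_fun (fun n : nat => iter n (horner f) z)].

Definition julia (R : realType) (f : {poly R[i]}) : set R[i] :=
  closure (filled_julia f) `\` interior (filled_julia f).

Definition has_period (T : Type) (f : T -> T) (n : nat) (z : T) : Prop :=
  [/\ (0 < n)%N, iter n f z = z &
      forall m : nat, (0 < m < n)%N -> iter m f z <> z].

(* Main.v *)
Require Import Defs.
From HB Require Import structures.
From mathcomp Require Import all_boot all_order all_algebra.
From mathcomp Require Import all_classical all_reals all_analysis.
From mathcomp.real_closed Require Import complex.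
From mathcomp Require Import ring lra.

Set Implicit Arguments.
Unset Strict Implicit.
Unset Printing Implicit Defensive.

Import Order.TTheory GRing.Theory Num.Theory.
Import numFieldNormedType.Exports.

Local Open Scope classical_set_scope.
Local Open Scope ring_scope.

(** Let z be a periodic point of f, say f^n(z) = z, isolated as a component of
the Julia set J, the boundary of the filled Julia set K.

Suppose first that z has a neighbourhood basis of open sets V whose boundaries
avoid K. Write f^(nk)(x) - z = (x - z) Q_k(x); the polynomial Q_k takes the
value m^k at z, where m = (f^n)'(z) is the multiplier. Choose one such V, cut
down to the points whose N-th iterate is below an escape radius: an orbit that
reaches the boundary of V has then left the closure of V one step later. The
points whose first k iterates under f^n stay in V form an open set W_k, and
on its boundary f^(nk) takes values on the boundary of V, at distance at least
d from z. For k large, the part of W_k in a much smaller neighbourhood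
V1 of z, of radius d/2, still has its whole boundary in that of W_k, so |Q_k| is
at least 2 on that boundary. When V is small, Q_k has no zero on W_k, because
m <> 0 (otherwise z would be superattracting, hence interior to K). The
minimum modulus principle then gives |m|^k >= 2, so |m| > 1
([isolated_point_repelling]). Every analytic step concerns a polynomial, and
the minimum principle for polynomials is the argument behind the fundamental
theorem of algebra ([horner_not_local_min]).

It remains to isolate z inside K by such V, whereas the hypothesis isolates z
only inside J. In the compact set J, a singleton component lies in arbitrarily
small relatively clopen subsets J1 ([isolate_component], by chains of small
steps). To extend a partition of J into J1 and J2 to a partition of K one needs
plane topology ([filled_separation]). Consider the jump that the indicator
function of K makes across J2, ignoring jumps across J1. It is a locally trivial
integer cocycle on the plane, hence the difference of an integer function T
([cocycle_primitive]). T is locally constant off K, and it is constant there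
because K has no hole, by the maximum principle for the iterates of f. On K
the function T is locally constant as well; it keeps the outer value near J1 and
differs from it near J2, so its level sets cut K as required. Finally, the piece
K1 of K containing J1 is no larger than J1 around z, as its farthest point from
z lies in J ([farthest_in_boundary]). *)

(** * The modulus as a real number *)

(** The norm of the complex numbers takes values in [R[i]], whose order is
partial; distances are compared in [R] instead. *)
Definition cabs (R : realType) (z : R[i]) : R := Normc.normc z.

Section modulus.
Context {R : realType}.
Implicit Types (x y z w : R[i]) (A B : set R[i]) (p : {poly R[i]}).

Lemma normE z : `|z| = (cabs z)%:C%C.
Proof. by rewrite normc_def; case: z. Qed.

Lemma cabs_ge0 z : 0 <= cabs z.
Proof. by rewrite -lecR -normE normr_ge0. Qed.

Lemma cabsM z w : cabs (z * w) = cabs z * cabs w.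
Proof. exact: Normc.normcM. Qed.

Lemma cabsN z : cabs (- z) = cabs z.
Proof. exact: normcN. Qed.

Lemma cabsC z w : cabs (z - w) = cabs (w - z).
Proof. by rewrite -cabsN opprB. Qed.

Lemma cabsD z w : cabs (z + w) <= cabs z + cabs w.
Proof. exact: le_normcD. Qed.

Lemma cabsB z w : cabs (z - w) <= cabs z + cabs w.
Proof. by rewrite -(cabsN w); exact: cabsD. Qed.

Lemma cabs_dist y x z : cabs (x - z) <= cabs (x - y) + cabs (y - z).
Proof. by rewrite -[x - z](subrKA y); exact: cabsD. Qed.

Lemma cabs0 : cabs (0 : R[i]) = 0.
Proof. exact: Normc.normc0. Qed.

Lemma cabs1 : cabs (1 : R[i]) = 1.
Proof. exact: Normc.normc1. Qed.

Lemma cabs_eq0 z : (cabs z == 0) = (z == 0).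
Proof.
apply/eqP/eqP => [|->]; last exact: cabs0.
exact: Normc.eq0_normc.
Qed.

Lemma cabs_gt0 z : (0 < cabs z) = (z != 0).
Proof. by rewrite lt_neqAle cabs_ge0 andbT eq_sym cabs_eq0. Qed.

Lemma cabsX z n : cabs (z ^+ n) = cabs z ^+ n.
Proof. by elim: n => [|n ih]; rewrite ?cabs1// !exprS cabsM ih. Qed.

Lemma cabs_real (r : R) : cabs r%:C%C = `|r|.
Proof. by rewrite /cabs /= expr0n /= addr0 sqrtr_sqr. Qed.

Lemma cabsV z : cabs z^-1 = (cabs z)^-1.
Proof. exact: Normc.normcV. Qed.

Lemma cabs_i : cabs ('i%C : R[i]) = 1.
Proof. by rewrite /cabs /= expr0n /= add0r expr1n sqrtr1. Qed.

Lemma cabsxx x : cabs (x - x) = 0.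
Proof. by rewrite subrr cabs0. Qed.

End modulus.

(* From here on the modulus is known through the lemmas above only. *)
Opaque cabs.

Section metric.
Context {R : realType}.
Implicit Types (x y z w : R[i]) (A B : set R[i]) (p : {poly R[i]}).

Lemma nbhs_cabsP x A :
  nbhs x A <-> exists2 e : R, 0 < e & forall y, cabs (x - y) < e -> A y.
Proof.
split=> [/nbhs_ballP[e /= e0 eA]|[e e0 eA]].
  have er : (complex.Re e)%:C%C = e by apply: RRe_real; exact: gtr0_real.
  exists (complex.Re e); first by rewrite -ltcR er.
  move=> y xy; apply: eA; rewrite -ball_normE /= normE -er ltcR //.
apply/nbhs_ballP; exists e%:C%C; first by rewrite /= ltcR.
by move=> y; rewrite -ball_normE /= normE ltcR => /eA.
Qed.

Lemma closure_cabsP A x :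
  closure A x <-> forall e : R, 0 < e -> exists2 y, A y & cabs (x - y) < e.
Proof.
split=> [clA e e0|clA U /nbhs_cabsP[e e0 eU]].
  have /clA[y [Ay ye]] : nbhs x [set y | cabs (x - y) < e].
    by apply/nbhs_cabsP; exists e.
  by exists y.
by have [y Ay xy] := clA e e0; exists y; split => //; exact: eU.
Qed.

Lemma open_cabsP A :
  open A <->
  forall x, A x -> exists2 e : R, 0 < e & forall y, cabs (x - y) < e -> A y.
Proof. by rewrite openE; split=> oA x /oA /nbhs_cabsP. Qed.

Lemma closed_cabs_le (e : R) x : closed [set y | cabs (x - y) <= e].
Proof.
move=> y /closure_cabsP cl /=; rewrite leNgt; apply/negP => ey.
have [|w /= xw yw] := cl (cabs (x - y) - e); first by rewrite subr_gt0.
by have := cabs_dist w x y; rewrite (cabsC w); lra.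
Qed.

Lemma continuous_cabsP (g : R[i] -> R) :
  (forall x (e : R), 0 < e -> exists2 d : R, 0 < d &
     forall y, cabs (x - y) < d -> `|g x - g y| < e) ->
  continuous g.
Proof.
move=> gP x U /nbhs_ballP[e /= e0 eU]; have [d d0 dg] := gP x e e0.
by apply/nbhs_cabsP; exists d => // y /dg ?; apply: eU; rewrite -ball_normE.
Qed.

Lemma continuous_cabsB x : continuous (fun y => cabs (x - y)).
Proof.
apply: continuous_cabsP => y e e0; exists e => // w yw.
apply: le_lt_trans yw; rewrite ler_norml.
have := cabs_dist w x y; have := cabs_dist y x w.
by rewrite (cabsC w y); lra.
Qed.

Lemma horner_bounded p (M : R) :
  exists2 B, 0 <= B & forall x, cabs x <= M -> cabs p.[x] <= B.
Proof.
elim/poly_ind: p => [|p c [B B0 pB]].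
  by exists 0 => // x _; rewrite horner0 cabs0.
exists (B * `|M| + cabs c) => [|x xM].
  by rewrite addr_ge0 ?cabs_ge0 ?mulr_ge0.
rewrite !hornerE; apply: le_trans (cabsD _ _) _; rewrite lerD2r cabsM.
by rewrite ler_pM ?cabs_ge0 ?pB// (le_trans xM)// ler_norm.
Qed.

(** The local Lipschitz bound carries all the continuity of polynomials that
is used below. *)
Lemma horner_lipschitz p (M : R) :
  exists2 L, 0 <= L & forall x y, cabs x <= M -> cabs y <= M ->
    cabs (p.[x] - p.[y]) <= L * cabs (x - y).
Proof.
elim/poly_ind: p => [|p c [L L0 pL]].
  by exists 0 => // x y _ _; rewrite !horner0 subrr cabs0 mul0r.
have [B B0 pB] := horner_bounded p M.
exists (B + L * `|M|) => [|x y xM yM]; first by rewrite addr_ge0 ?mulr_ge0.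
have -> : (p * 'X + c%:P).[x] - (p * 'X + c%:P).[y] =
    p.[x] * (x - y) + (p.[x] - p.[y]) * y.
  by rewrite !hornerE; ring.
apply: le_trans (cabsD _ _) _; rewrite !cabsM mulrDl lerD//.
  by rewrite ler_wpM2r ?cabs_ge0 ?pB.
rewrite mulrAC ler_pM ?cabs_ge0 ?pL//.
by rewrite (le_trans yM)// ler_norm.
Qed.

Lemma horner_eps_delta p x (e : R) : 0 < e ->
  exists2 d : R, 0 < d & forall y, cabs (x - y) < d -> cabs (p.[x] - p.[y]) < e.
Proof.
move=> e0; have [L L0 pL] := horner_lipschitz p (cabs x + 1).
exists (Num.min 1 (e / (L + 1))) => [|y].
  by rewrite lt_min ltr01 divr_gt0// ltr_wpDl.
rewrite lt_min => /andP[xy1 xye].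
have xM : cabs x <= cabs x + 1 by rewrite lerDl.
have yM : cabs y <= cabs x + 1.
  have := cabsB x (x - y); rewrite subKr; lra.
apply: le_lt_trans (pL _ _ xM yM) _.
rewrite ltr_pdivlMr in xye; last by rewrite ltr_wpDl.
by apply: le_lt_trans xye; rewrite mulrC ler_wpM2l ?cabs_ge0// lerDl.
Qed.

Lemma continuous_cabs_horner p : continuous (fun x => cabs p.[x]).
Proof.
apply: continuous_cabsP => x e e0; have [d d0 dp] := horner_eps_delta p x e0.
exists d => // y /dp; apply: le_lt_trans; rewrite ler_norml.
have := cabsB p.[x] (p.[x] - p.[y]); have := cabsD p.[y] (p.[x] - p.[y]).
by rewrite subKr (addrC p.[y]) subrK; lra.
Qed.

(** * Compactness *)

Lemma cabs_le_ReIm x : cabs x <= `|complex.Re x| + `|complex.Im x|.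
Proof.
have -> : x = (complex.Re x)%:C%C + 'i%C * (complex.Im x)%:C%C.
  exact: complexE.
apply: le_trans (cabsD _ _) _; rewrite cabsM !cabs_real cabs_i.
by case: x => a b /=; rewrite !(mul0r, mul1r, mulr0, mulr1, addr0, add0r, subr0).
Qed.

Lemma Re_le_cabs x : `|complex.Re x| <= cabs x.
Proof. by have := normc_ge_Re x; rewrite normE lecR. Qed.

Lemma Im_le_cabs x : `|complex.Im x| <= cabs x.
Proof.
by have := Re_le_cabs (x * 'i%C); rewrite ReiNIm normrN cabsM cabs_i mulr1.
Qed.

(** Heine-Borel, by mapping a compact square of the real plane onto a square of
the complex plane. *)
Lemma bounded_closed_compactC A (M : R) :
  closed A -> (forall x, A x -> cabs x <= M) -> compact A.
Proof.
move=> cA AM.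
pose g (u : R * R) : R[i] := (u.1 +i* u.2)%C.
have cg : continuous g.
  move=> u U /nbhs_cabsP[e e0 eU].
  apply/nbhs_ballP; exists (e / 2); first by rewrite /= divr_gt0.
  move=> v []; rewrite -!ball_normE /= => uv1 uv2; apply: eU.
  apply: le_lt_trans (cabs_le_ReIm _) _; rewrite /g /=; lra.
have cK : compact (g @` (`[-M, M]%classic `*` `[-M, M]%classic)).
  apply: continuous_compact; first exact: continuous_subspaceT.
  by apply: compact_setX; exact: segment_compact.
apply: (subclosed_compact cA cK) => x /AM xM.
exists (complex.Re x, complex.Im x); last by case: x xM.
have := Re_le_cabs x; have := Im_le_cabs x.
rewrite !ler_norml => /andP[? ?] /andP[? ?].
by split; rewrite /= in_itv /=; apply/andP; split; lra.
Qed.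

End metric.

(** Cantor's intersection theorem: a cluster point of a sequence picked in the
sets belongs to all of them. *)
Lemma compact_nested (T : topologicalType) (K : set T) (F : nat -> set T) :
  compact K -> (forall n, closed (F n)) -> (forall n, F n.+1 `<=` F n) ->
  (forall n, K `&` F n !=set0) -> K `&` \bigcap_n F n !=set0.
Proof.
move=> cK cF dF /choice[x Kx].
have F_le m n : (m <= n)%N -> F n `<=` F m.
  elim: n => [|n ih]; first by rewrite leqn0 => /eqP ->.
  by rewrite leq_eqVlt => /predU1P[-> //|/ih] mn; exact: subset_trans (dF n) mn.
have [|p [Kp clp]] := cK (x @ \oo) _.
  by exists 0%N => // n _; case: (Kx n).
exists p; split => // n _; apply: cF => U pU.
apply: clp pU; exists n => // m /= nm.
by case: (Kx m) => _; exact: F_le.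
Qed.

(** * The minimum and maximum modulus principles for polynomials *)

Section modulus_principles.
Context {R : realType}.
Implicit Types (x y z w : R[i]) (S : set R[i]) (p : {poly R[i]}).

(** Near x, p is p(x) + b (y - x)^m up to higher order terms; moving in a
direction u with u^m = - p(x) / b decreases the modulus. *)
Lemma horner_not_local_min p x (e : R) :
  (1 < size p)%N -> p.[x] != 0 -> 0 < e ->
  exists2 y, cabs (x - y) < e & cabs p.[y] < cabs p.[x].
Proof.
move=> p1 px e0; set c := p.[x].
have pc0 : p - c%:P != 0.
  rewrite subr_eq0; apply: contraTneq p1 => ->.
  by rewrite -leqNgt size_polyC leq_b1.
have [m [q]] := multiplicity_XsubC (p - c%:P) x; rewrite pc0 /= => qx pE.
have m0 : (0 < m)%N.
  rewrite lt0n; apply: contraNneq qx => m0; move: pE; rewrite m0 expr0 mulr1 => <-.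
  by rewrite /root !hornerE subrr.
set b := q.[x]; have b0 : b != 0 by exact: qx.
have [u] : exists u : R[i], root ('X^m - (- c / b)%:P) u.
  by apply/closed_rootP; rewrite size_XnsubC// eqSS -lt0n.
rewrite /root !hornerE subr_eq0 => /eqP um.
have [d d0 dq] : exists2 d : R, 0 < d &
    forall y, cabs (x - y) < d -> cabs (b - q.[y]) < cabs b.
  by apply: horner_eps_delta; rewrite cabs_gt0.
(* The step t is chosen so that t |u| is below both d and e, and t < 1. *)
pose d' := Num.min d e.
have d'0 : 0 < d' by rewrite lt_min d0.
have den0 : 0 < d' + cabs u + 1 by have := cabs_ge0 u; lra.
pose t := d' / (d' + cabs u + 1).
have t0 : 0 < t by rewrite divr_gt0.
have t1 : t < 1 by rewrite ltr_pdivrMr// mul1r; have := cabs_ge0 u; lra.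
pose y := x + t%:C%C * u.
have xy : cabs (x - y) < d'.
  rewrite /y opprD addNKr cabsN cabsM cabs_real gtr0_norm//.
  rewrite /t mulrAC ltr_pdivrMr// ltr_pM2l//; lra.
move: xy; rewrite lt_min => /andP[xyd xye].
exists y => //.
have tm0 : 0 < t ^+ m by exact: exprn_gt0.
have tm1 : t ^+ m <= 1 by rewrite exprn_ile1// ltW.
have -> : p.[y] = c * (1 - t ^+ m)%:C%C + (t ^+ m)%:C%C * ((q.[y] - b) * u ^+ m).
  have -> : p.[y] = (p - c%:P).[y] + c by rewrite !hornerE subrK.
  rewrite pE !hornerE /y addrAC subrr add0r exprMn um.
  rewrite rmorphB rmorph1 !rmorphXn /=.
  by field.
apply: le_lt_trans (cabsD _ _) _; rewrite !cabsM !cabs_real.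
rewrite ger0_norm ?subr_ge0// (gtr0_norm tm0) um cabsM cabsN.
have cb : cabs b * cabs b^-1 = 1 by rewrite -cabsM divff// cabs1.
have c0 : 0 < cabs c by rewrite cabs_gt0.
have bi0 : 0 < cabs b^-1 by rewrite cabs_gt0 invr_eq0.
have qb1 : cabs (q.[y] - b) * cabs b^-1 < 1.
  by rewrite -cb ltr_pM2r// cabsC; exact: dq.
have tc0 : 0 < t ^+ m * cabs c by rewrite mulr_gt0.
by move: qb1; rewrite -(ltr_pM2l tc0); lra.
Qed.

Lemma closure_bounded S (M : R) x :
  (forall y, S y -> cabs y <= M) -> closure S x -> cabs x <= M.
Proof.
move=> SM /(closureS _ )-/(_ [set y | cabs (0 - y) <= M]) h.
have /closure_id E := @closed_cabs_le R M 0.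
by move: h; rewrite -E /= sub0r cabsN; apply => y; rewrite /= sub0r cabsN; exact: SM.
Qed.

(** The minimum over the compact closure of S cannot be attained in S, by
[horner_not_local_min]. *)
Lemma minimum_modulus p S (m M : R) :
  (1 < size p)%N -> open S -> (forall x, S x -> cabs x <= M) ->
  (forall x, S x -> p.[x] != 0) ->
  (forall x, closure S x -> ~ S x -> m <= cabs p.[x]) ->
  forall x, S x -> m <= cabs p.[x].
Proof.
move=> p1 oS SM S0 Sm x Sx.
have cS : compact (closure S).
  apply: (@bounded_closed_compactC _ _ M); first exact: closed_closure.
  by move=> y; exact: closure_bounded.
have [|y /set_mem clSy ymin] := compact_EVT_min _ cS
    (continuous_subspaceT (@continuous_cabs_horner _ p)).
  by exists x; exact: subset_closure.
apply: le_trans (ymin _ (mem_set (subset_closure Sx))).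
have [Sy|] := pselect (S y); last exact: Sm.
have [e e0 eS] := (open_cabsP S).1 oS y Sy.
have [w yw] := horner_not_local_min p1 (S0 _ Sy) e0.
by rewrite ltNge ymin//; apply/mem_set/subset_closure/eS.
Qed.

(** Deduced from the minimum principle: if |p| exceeded m at x, then T u - p,
with u the direction of p(x) and T above all values of |p| on S, would have
no zero in S and be smaller at x than on the boundary. *)
Lemma maximum_modulus p S (m M : R) :
  (1 < size p)%N -> open S -> (forall x, S x -> cabs x <= M) -> 0 <= m ->
  (forall x, closure S x -> ~ S x -> cabs p.[x] <= m) ->
  forall x, S x -> cabs p.[x] <= m.
Proof.
move=> p1 oS SM m0 Sm x Sx; rewrite leNgt; apply/negP => mx.
have [B B0 pB] := horner_bounded p M.
have px0 : 0 < cabs p.[x] by exact: le_lt_trans mx.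
pose u := p.[x] / (cabs p.[x])%:C%C.
have u1 : cabs u = 1.
  by rewrite cabsM cabsV cabs_real gtr0_norm// divff ?gt_eqF.
have xE : p.[x] = (cabs p.[x])%:C%C * u.
  rewrite mulrC divfK// -cabs_eq0 cabs_real gtr0_norm ?gt_eqF//.
move: u u1 xE => u u1 xE; pose T := B + 1.
have pT y : S y -> cabs p.[y] < T by move=> /SM/pB; rewrite /T; lra.
have TuE : cabs (T%:C%C * u) = T.
  by rewrite cabsM u1 mulr1 cabs_real gtr0_norm//; rewrite /T; lra.
have QT y : T - cabs p.[y] <= cabs ((T%:C%C * u)%:P - p).[y].
  rewrite !hornerE; have := cabsD (T%:C%C * u - p.[y]) p.[y].
  by rewrite subrK TuE; lra.
have sQ : (1 < size ((T%:C%C * u)%:P - p)%R)%N.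
  rewrite addrC size_polyDl size_polyN//.
  by apply: leq_ltn_trans p1; rewrite size_polyC leq_b1.
have Qx : cabs ((T%:C%C * u)%:P - p).[x] = T - cabs p.[x].
  rewrite hornerD hornerC hornerN [in LHS]xE -mulrBl -rmorphB.
  by rewrite cabsM u1 mulr1 cabs_real gtr0_norm ?subr_gt0 ?pT.
have QS y : S y -> ((T%:C%C * u)%:P - p).[y] != 0.
  by move=> Sy; rewrite -cabs_gt0; have := QT y; have := pT _ Sy; lra.
have Qb y : closure S y -> ~ S y -> T - m <= cabs ((T%:C%C * u)%:P - p).[y].
  by move=> cy ny; have := Sm _ cy ny; have := QT y; lra.
have := minimum_modulus sQ oS SM QS Qb Sx.
by rewrite Qx; lra.
Qed.

End modulus_principles.

(** * Isolating a singleton component *)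

Section chains.
Context {R : realType}.
Implicit Types (x y z w : R[i]) (A B J : set R[i]).

(** The points of J reachable from z by steps in J of length less than e, as the
smallest set closed under such steps. *)
Definition chain_component J z (e : R) : set R[i] :=
  [set x | forall A, A z ->
     (forall y w, A y -> J w -> cabs (y - w) < e -> A w) -> A x].

Lemma chain_component_self J z (e : R) : chain_component J z e z.
Proof. by move=> A. Qed.

Lemma chain_component_step J z (e : R) x y :
  chain_component J z e x -> J y -> cabs (x - y) < e -> chain_component J z e y.
Proof. by move=> Cx Jy xy A Az AS; apply: AS (Cx A Az AS) Jy xy. Qed.

Lemma chain_component_sub J z (e : R) :
  J z -> chain_component J z e `<=` J.
Proof. by move=> Jz x; apply. Qed.

Lemma chain_component_mono J z (e e' : R) : e <= e' ->
  chain_component J z e `<=` chain_component J z e'.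
Proof.
move=> ee' x Cx A Az AS; apply: Cx => // y w Ay Jw yw.
by apply: AS Ay Jw _; exact: lt_le_trans ee'.
Qed.

Lemma closed_chain_component J z (e : R) : 0 < e -> J z -> closed J ->
  closed (chain_component J z e).
Proof.
move=> e0 Jz cJ x /closure_cabsP clx.
have Jx : J x.
  apply: cJ; apply/closure_cabsP => d /clx[y Cy xy]; exists y => //.
  exact: chain_component_sub Cy.
have [y Cy xy] := clx _ e0.
by apply: chain_component_step Cy Jx _; rewrite cabsC.
Qed.

Lemma closed_far_from A (e : R) :
  closed [set x | forall a, A a -> e <= cabs (x - a)].
Proof.
move=> x /closure_cabsP clx a Aa; rewrite leNgt; apply/negP => xa.
have [|y /(_ _ Aa) ya xy] := clx (e - cabs (x - a)); first by rewrite subr_gt0.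
have := cabs_dist x y a; rewrite (cabsC y x); lra.
Qed.

Lemma invS_gt0 n : 0 < n.+1%:R^-1 :> R.
Proof. by rewrite invr_gt0. Qed.

Lemma invS_small (e : R) : 0 < e ->
  exists n, forall m, (n <= m)%N -> m.+1%:R^-1 < e.
Proof.
move=> e0; exists (Num.truncn e^-1) => m nm.
rewrite invf_plt ?posrE//; apply: lt_le_trans (truncnS_gt _) _.
by rewrite ler_nat ltnS.
Qed.

Lemma invS_decr n m : (n <= m)%N -> m.+1%:R^-1 <= n.+1%:R^-1 :> R.
Proof. by move=> nm; rewrite lef_pV2 ?posrE// ler_nat. Qed.

Lemma compact_closed_dist A B : compact A -> closed B -> A `&` B = set0 ->
  exists2 e : R, 0 < e & forall a b, A a -> B b -> e <= cabs (a - b).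
Proof.
move=> cA cB AB0; apply: contrapT => nE.
pose F n := closure [set a | A a /\ exists2 b, B b & cabs (a - b) < n.+1%:R^-1].
have [|n|n|p [Ap Fp]] := @compact_nested _ A F cA.
- by move=> n; exact: closed_closure.
- apply: closureS => a [Aa [b Bb ab]]; split => //; exists b => //.
  by apply: lt_le_trans ab (invS_decr _).
- apply: contrapT => nF; apply: nE; exists n.+1%:R^-1; first exact: invS_gt0.
  move=> a b Aa Bb; rewrite leNgt; apply/negP => ab; apply: nF.
  by exists a; split => //; apply: subset_closure; split => //; exists b.
have Bp : B p.
  apply: cB; apply/closure_cabsP => e e0.
  have e20 : 0 < e / 2 by rewrite divr_gt0.
  have [n /(_ n (leqnn n)) ne] := invS_small e20.
  have /closure_cabsP/(_ _ e20)[a [_ [b Bb ab]] pa] := Fp n I.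
  by exists b => //; have := cabs_dist a p b; have := lt_trans ab ne; lra.
by have : (A `&` B) p by []; rewrite AB0.
Qed.

(** The heart of the connectedness of the limit Q of the chain components. If Q
split into A, containing z, and a nonempty B at distance e from A, then every
fine enough chain from z to B would pass through the points at distance at
least e/3 from both; by compactness so would Q. *)
Lemma chain_limit_clopen J z A B : closed J -> compact J -> J z ->
  let Q := [set x | forall e : R, 0 < e -> chain_component J z e x] in
  closed A -> closed B -> A `&` B = set0 -> A `|` B = Q -> A z -> B = set0.
Proof.
move=> cJ kJ Jz Q cA cB AB0 ABQ Az.
apply/eqP; apply: contrapT => /negP/set0P[b Bb].
have QJ : Q `<=` J by move=> x /(_ 1 ltr01); exact: chain_component_sub.
have kA : compact A.
  by apply: subclosed_compact kJ _ => //; apply: subset_trans QJ; rewrite -ABQ.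
have [e e0 ABe] := compact_closed_dist kA cB AB0.
pose h := e / 3; have h0 : 0 < h by rewrite divr_gt0.
have [N Nh] := invS_small h0.
pose F n := chain_component J z (n + N).+1%:R^-1 `&`
  ([set x | forall a, A a -> h <= cabs (x - a)] `&`
   [set x | forall a, B a -> h <= cabs (x - a)]).
have [n|n|n|q [Jq Fq]] := @compact_nested _ J F kJ.
- apply: closedI; first by apply: closed_chain_component => //; exact: invS_gt0.
  by apply: closedI; exact: closed_far_from.
- move=> x [Cx ?]; split => //; apply: chain_component_mono Cx.
  by apply: invS_decr; rewrite leq_add2r.
- apply: contrapT => nF.
  have Nn : (n + N).+1%:R^-1 < h by apply: Nh; rewrite leq_addl.
  have : Q b by rewrite -ABQ; right.
  move=> /(_ _ (invS_gt0 (n + N))) Cb.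
  have [||_ [a Aa ba]] := Cb [set x | chain_component J z (n + N).+1%:R^-1 x /\
      exists2 a, A a & cabs (x - a) < h].
  + split; first exact: chain_component_self.
    by exists z => //; rewrite cabsxx.
  + move=> x y [Cx [a Aa xa]] Jy xy.
    have Cy := chain_component_step Cx Jy xy; split => //.
    apply: contrapT => nA; apply: nF; exists y; split => //; split => //; split => c.
      by move=> Ac; rewrite leNgt; apply/negP => yc; apply: nA; exists c.
    move=> Bc; rewrite leNgt; apply/negP => yc.
    have := ABe _ _ Aa Bc; have := cabs_dist x a c; have := cabs_dist y x c.
    have := lt_trans xy Nn; rewrite (cabsC a x) /h in yc xa *; lra.
  have := ABe _ _ Aa Bb; rewrite cabsC; rewrite /h in ba; lra.
have Qq : Q q.
  move=> d d0; have [n nd] := invS_small d0.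
  have [Cq _] := Fq n I; apply: chain_component_mono Cq.
  by apply/ltW/nd; rewrite leq_addr.
have [_ [qA qB]] := Fq 0%N I.
have : (A `|` B) q by rewrite ABQ.
by case=> [/qA|/qB]; rewrite cabsxx leNgt h0.
Qed.

(** The limit of the chain components of z is connected, hence reduced to z;
so one of them is already small, and it is separated from the rest of J. *)
Lemma isolate_component J z (r : R) : compact J -> closed J -> J z ->
  connected_component J z = [set z] -> 0 < r ->
  exists J1, exists2 e : R, 0 < e &
    [/\ J1 `<=` J, J1 z, forall x, J1 x -> cabs (z - x) < r &
        forall x y, J1 x -> J y -> ~ J1 y -> e <= cabs (x - y)].
Proof.
move=> kJ cJ Jz compz r0; apply: contrapT => nE.
pose Q := [set x | forall e : R, 0 < e -> chain_component J z e x].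
pose F n := chain_component J z n.+1%:R^-1 `&`
  [set x | forall a, [set z] a -> r <= cabs (x - a)].
have [n|n|n|q [Jq Fq]] := @compact_nested _ J F kJ.
- apply: closedI; first by apply: closed_chain_component => //; exact: invS_gt0.
  exact: closed_far_from.
- move=> x [Cx ?]; split => //; apply: chain_component_mono Cx.
  exact: invS_decr.
- apply: contrapT => nF; apply: nE.
  exists (chain_component J z n.+1%:R^-1), n.+1%:R^-1; first exact: invS_gt0.
  split.
  + exact: chain_component_sub.
  + exact: chain_component_self.
  + move=> x Cx; rewrite ltNge; apply/negP => zx; apply: nF; exists x; split.
      exact: chain_component_sub Cx.
    by split => // _ ->; rewrite cabsC.
  + move=> x y Cx Jy nCy; rewrite leNgt; apply/negP => xy; apply: nCy.
    exact: chain_component_step Cx Jy xy.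
have Qq : Q q.
  move=> d d0; have [n nd] := invS_small d0.
  have [Cq _] := Fq n I; apply: chain_component_mono Cq.
  exact/ltW/nd.
have cQ : closed Q.
  move=> x /closure_cabsP clx e e0.
  apply: (closed_chain_component e0 Jz cJ).
  by apply/closure_cabsP => d /clx[y Qy xy]; exists y => //; exact: Qy.
have Qz : Q z by move=> e _; exact: chain_component_self.
have conQ : connected Q.
  move=> B [b Bb] [U oU BU] [V cV BV].
  have cB : closed B by rewrite BV; exact: closedI.
  have cD : closed (Q `\` B).
    suff -> : Q `\` B = Q `&` ~` U by apply: closedI => //; exact: open_closedC.
    apply/seteqP; split=> x [Qx nx]; split => //.
      by move=> Ux; apply: nx; rewrite BU.
    by rewrite BU => -[].
  have BQ : B `<=` Q by rewrite BU; exact: subIsetl.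
  have E : B `|` (Q `\` B) = Q by rewrite setDUK.
  have D0 : B `&` (Q `\` B) = set0 by rewrite setDIK.
  have [Bz|nBz] := pselect (B z).
    have := chain_limit_clopen cJ kJ Jz cB cD D0 E Bz.
    by move=> D; rewrite -E D setU0.
  have := @chain_limit_clopen J z _ B cJ kJ Jz cD cB.
  rewrite setIC D0 setUC E => /(_ erefl erefl) B0.
  by move: Bb; rewrite B0.
have QJ : Q `<=` J by move=> x /(_ 1 ltr01); exact: chain_component_sub.
have := @connected_component_max _ J Q z Qz QJ conQ.
rewrite compz => /(_ q Qq) qz.
by have [_ /(_ z erefl)] := Fq 0%N I; rewrite qz cabsxx leNgt r0.
Qed.

End chains.

(** * A planar separation theorem *)

Section planar.
Context {R : realType}.
Implicit Types (x y z w a b d : R[i]) (K J S : set R[i]).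

Definition segment a b (t : R) : R[i] := a + t%:C%C * (b - a).

Lemma segment_dist a b (s t : R) :
  cabs (segment a b s - segment a b t) = `|s - t| * cabs (a - b).
Proof.
have -> : segment a b s - segment a b t = (s - t)%:C%C * (b - a).
  by rewrite /segment rmorphB /=; ring.
by rewrite cabsM cabs_real (cabsC b).
Qed.

Lemma segment0 a b : segment a b 0 = a.
Proof. by rewrite /segment mul0r addr0. Qed.

Lemma segment1 a b : segment a b 1 = b.
Proof. by rewrite /segment mul1r addrC subrK. Qed.

Lemma Re_mul_segment u a b (t : R) :
  complex.Re (u * segment a b t) =
  (1 - t) * complex.Re (u * a) + t * complex.Re (u * b).
Proof. by rewrite /segment; case: u a b => [? ?] [? ?] [? ?] /=; ring. Qed.

Lemma cabs_segment a b (t M : R) : 0 <= t <= 1 -> cabs a <= M -> cabs b <= M ->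
  cabs (segment a b t) <= M.
Proof.
move=> /andP[t0 t1] aM bM.
have -> : segment a b t = (1 - t)%:C%C * a + t%:C%C * b.
  by rewrite /segment rmorphB rmorph1 /=; ring.
apply: le_trans (cabsD _ _) _; rewrite !cabsM !cabs_real !ger0_norm ?subr_ge0//.
have := ler_wpM2l t0 bM; have t1' : 0 <= 1 - t by rewrite subr_ge0.
by have := ler_wpM2l t1' aM; lra.
Qed.

Lemma segment_locally_constant (T : R[i] -> int) a b (e : R) : 0 < e ->
  (forall s t : R, 0 <= s <= 1 -> 0 <= t <= 1 ->
     cabs (segment a b s - segment a b t) < e ->
     T (segment a b s) = T (segment a b t)) -> T a = T b.
Proof.
move=> e0 TE.
have d0 : 0 < e / (cabs (a - b) + 1) by rewrite divr_gt0// ltr_wpDl// cabs_ge0.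
have [n /(_ n (leqnn n)) nd] := invS_small d0.
suff H k : (k <= n.+1)%N -> T (segment a b (k%:R / n.+1%:R)) = T a.
  by rewrite -(H n.+1)// divff ?pnatr_eq0// segment1.
have unit_k m : (m <= n.+1)%N -> 0 <= (m%:R / n.+1%:R : R) <= 1.
  by move=> mn; rewrite divr_ge0//= ler_pdivrMr// mul1r ler_nat.
elim: k => [|k ih] kn; first by rewrite mul0r segment0.
rewrite -ih ?(ltnW kn)//; apply: TE; rewrite ?unit_k// ?(ltnW kn)//.
rewrite segment_dist -mulrBl -natrB// subSnn mul1r gtr0_norm ?invS_gt0//.
rewrite ltr_pdivlMr in nd; last by rewrite ltr_wpDl// cabs_ge0.
by apply: le_lt_trans nd; rewrite ler_wpM2l ?lerDl// ltW// invS_gt0.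
Qed.

(** The outer annulus is covered by four convex sets, the intersections of the
disc of radius 4 r with the half planes at distance r from the origin in the
axis directions; consecutive ones share a corner of the square of half side
r. *)
Lemma annulus_locally_constant (T : R[i] -> int) (r e : R) : 0 < r -> 0 < e ->
  (forall x y, r <= cabs x <= 4 * r -> r <= cabs y <= 4 * r ->
     cabs (x - y) < e -> T x = T y) ->
  forall x y, 2 * r <= cabs x <= 4 * r -> 2 * r <= cabs y <= 4 * r -> T x = T y.
Proof.
move=> r0 e0 TE.
(* A half plane is given by the direction u: r <= Re (u x). *)
have half u a b : cabs u = 1 -> cabs a <= 4 * r -> cabs b <= 4 * r ->
    r <= complex.Re (u * a) -> r <= complex.Re (u * b) -> T a = T b.
  move=> u1 aM bM ra rb; apply: (segment_locally_constant e0) => s t s01 t01.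
  have H (v : R) : 0 <= v <= 1 -> r <= cabs (segment a b v) <= 4 * r.
    move=> v01; rewrite cabs_segment// andbT.
    have -> : cabs (segment a b v) = cabs (u * segment a b v).
      by rewrite cabsM u1 mul1r.
    apply: le_trans (le_trans (ler_norm _) (Re_le_cabs _)).
    rewrite Re_mul_segment; case/andP: v01 => v0 v1.
    have v1' : 0 <= 1 - v by rewrite subr_ge0.
    by have := ler_wpM2l v0 rb; have := ler_wpM2l v1' ra; lra.
  by apply: TE; exact: H.
pose corner (s t : R) : R[i] := ((s * r) +i* (t * r))%C.
have cornerM s t : `|s| <= 1 -> `|t| <= 1 -> cabs (corner s t) <= 4 * r.
  move=> s1 t1; apply: le_trans (cabs_le_ReIm _) _ => /=.
  rewrite !normrM (gtr0_norm r0).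
  by have := ler_wpM2r (ltW r0) s1; have := ler_wpM2r (ltW r0) t1; lra.
suff H x : 2 * r <= cabs x <= 4 * r -> T x = T (corner 1 1).
  by move=> x y hx hy; rewrite !H.
have c11 : cabs (corner 1 1) <= 4 * r by apply: cornerM; rewrite normr1.
move=> /andP[rx xM].
have : (r <= complex.Re x \/ r <= complex.Im x) \/
       (complex.Re x <= - r \/ complex.Im x <= - r).
  have := le_trans rx (cabs_le_ReIm x).
  have [|n1] := lerP r (complex.Re x); first by left; left.
  have [|n2] := lerP r (complex.Im x); first by left; right.
  have [|n3] := lerP (complex.Re x) (- r); first by right; left.
  have [|n4] := lerP (complex.Im x) (- r); first by right; right.
  have : `|complex.Re x| < r by rewrite ltr_norml n3 n1.
  have : `|complex.Im x| < r by rewrite ltr_norml n4 n2.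
  lra.
case=> [[h|h]|[h|h]].
- apply: (half 1); rewrite ?cabs1 ?mul1r//= ?mul1r//.
- by apply: (half (- 'i%C)); rewrite ?cabsN ?cabs_i//; case: x {rx xM} h => ? ? /=; lra.
- transitivity (T (corner (-1) 1)).
    apply: (half (-1)); rewrite ?cabsN ?cabs1 ?cornerM ?normrN ?normr1//.
      by case: x {rx xM} h => ? ? /=; lra.
    by rewrite /=; lra.
  apply: (half (- 'i%C)); rewrite ?cabsN ?cabs_i ?cornerM ?normrN ?normr1//=; lra.
- transitivity (T (corner 1 (-1))).
    apply: (half 'i%C); rewrite ?cabs_i ?cornerM ?normrN ?normr1//.
      by case: x {rx xM} h => ? ? /=; lra.
    by rewrite /=; lra.
  apply: (half 1); rewrite ?cabs1 ?cornerM ?normrN ?normr1//=; lra.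
Qed.

(** A cocycle defined for small displacements is a coboundary on a disc: T is
the sum of c along a fine subdivision of the ray from 0. For neighbouring end
points z and w the two subdivided rays bound a ladder of small quadrilaterals,
around each of which c sums to zero. *)
Lemma cocycle_primitive (c : R[i] -> R[i] -> int) (e M : R) : 0 < e -> 0 <= M ->
  (forall a b d, cabs (a - b) < e -> cabs (b - d) < e -> cabs (a - d) < e ->
     c a b + c b d = c a d) ->
  exists T : R[i] -> int, forall z w, cabs z <= M -> cabs w <= M ->
    cabs (z - w) < e / 2 -> T w - T z = c z w.
Proof.
move=> e0 M0 cE.
have d0 : 0 < e / 2 / (M + 1) by rewrite !divr_gt0// ltr_wpDl.
have [n /(_ n (leqnn n)) nd] := invS_small d0.
rewrite ltr_pdivlMr ?ltr_wpDl// in nd.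
pose pt z k : R[i] := (k%:R / n.+1%:R)%:C%C * z.
exists (fun z => \sum_(k < n.+1) c (pt z k) (pt z k.+1)) => z w zM wM zw.
have step y k : cabs y <= M -> cabs (pt y k - pt y k.+1) < e / 2.
  move=> yM; rewrite -mulrBl -rmorphB -mulrBl cabsM cabs_real normrM.
  rewrite distrC -natrB// subSnn normr1 mul1r (gtr0_norm (invS_gt0 n)).
  apply: le_lt_trans nd; apply: ler_wpM2l; first exact: ltW (invS_gt0 n).
  by lra.
have across k : (k <= n.+1)%N -> cabs (pt z k - pt w k) < e / 2.
  move=> kn; rewrite -mulrBr cabsM cabs_real ger0_norm ?divr_ge0//.
  apply: le_lt_trans zw; rewrite -[leRHS]mul1r ler_wpM2r ?cabs_ge0//.
  by rewrite ler_pdivrMr// mul1r ler_nat.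
have diag k : (k < n.+1)%N -> cabs (pt z k - pt w k.+1) < e.
  move=> kn; have := cabs_dist (pt z k.+1) (pt z k) (pt w k.+1).
  by have := step z k zM; have := across k.+1 kn; lra.
have half_e x y : cabs (x - y) < e / 2 -> cabs (x - y) < e by lra.
suff H j : (j <= n.+1)%N -> \sum_(k < j) c (pt w k) (pt w k.+1) -
    \sum_(k < j) c (pt z k) (pt z k.+1) = c (pt z j) (pt w j).
  by rewrite H// /pt divff ?pnatr_eq0// !mul1r.
elim: j => [|j ih] jn.
  rewrite !big_ord0 subr0 /pt !mul0r.
  have := cE 0 0 0; rewrite cabsxx => /(_ e0 e0 e0) c00.
  by apply: (addrI (c 0 0)); rewrite c00 addr0.
rewrite !big_ord_recr /=.
have E1 := cE _ _ _ (half_e _ _ (across _ (ltnW jn))) (half_e _ _ (step w j wM)) (diag _ jn).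
have E2 := cE _ _ _ (half_e _ _ (step z j zM)) (half_e _ _ (across _ jn)) (diag _ jn).
by have := ih (ltnW jn); lra.
Qed.

(** The point of K nearest to b is on the boundary of K: a step towards b
would bring it nearer. It lies close to both a and b when these are close,
and so replaces the crossing point of the segment with the boundary. *)
Lemma nearest_is_boundary K a b : compact K -> K a -> ~ K b ->
  exists p, [/\ K p, ~ interior K p & cabs (b - p) <= cabs (a - b)].
Proof.
move=> cK Ka nKb.
have [|p /set_mem Kp pmin] := compact_EVT_min _ cK
  (continuous_subspaceT (@continuous_cabsB _ b)); first by exists a.
exists p; split => //; last by rewrite (cabsC a); apply: pmin; exact: mem_set.
move=> /nbhs_cabsP[e e0 eK].
have bp : 0 < cabs (p - b).
  by rewrite cabs_gt0 subr_eq0; apply: contra_not_neq nKb => <-.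
pose t := e / (e + cabs (p - b)).
have den : 0 < e + cabs (p - b) by rewrite addr_gt0.
have t0 : 0 < t by rewrite divr_gt0.
have t1 : t < 1 by rewrite ltr_pdivrMr//; lra.
have Kq : K (segment p b t).
  apply: eK; rewrite -{1}(segment0 p b) segment_dist sub0r normrN gtr0_norm//.
  by rewrite /t mulrAC ltr_pdivrMr// ltr_pM2l//; lra.
have := pmin _ (mem_set Kq).
rewrite -{2}(segment1 p b) segment_dist gtr0_norm ?subr_gt0//.
by rewrite (cabsC b) leNgt -[ltRHS]mul1r ltr_pM2r//; lra.
Qed.

(** The last hypothesis says that K has no hole. The cocycle c(a, b) is the jump
of the indicator function of K from a to b when a is near J2, and 0 otherwise;
the level sets of its primitive T cut K. *)
Lemma filled_separation K J1 J2 (e r : R) :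
  compact K -> closed K -> 0 < e -> 0 < r -> (forall x, K x -> cabs x < r) ->
  (forall x, K x -> ~ interior K x -> J1 x \/ J2 x) ->
  (forall x y, J1 x -> J2 y -> 6 * e <= cabs (x - y)) ->
  (forall S, open S -> (forall x, S x -> cabs x <= 3 * r) ->
     (forall x, S x -> ~ K x) -> (forall x, closure S x -> ~ S x -> K x) ->
     S = set0) ->
  exists2 K1, K1 `<=` K &
    [/\ forall x, K x -> ~ interior K x -> J1 x -> K1 x,
        forall x, K x -> ~ interior K x -> J2 x -> ~ K1 x &
        forall x y, K1 x -> K y -> ~ K1 y -> e / 2 <= cabs (x - y)].
Proof.
move=> kK cK e0 r0 Kr KJ J12 full.
pose chi x : int := (`[< K x >] : nat)%:Z.
have chi_in x : K x -> chi x = 1 by move=> Kx; rewrite /chi asboolT.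
have chi_out x : ~ K x -> chi x = 0 by move=> Kx; rewrite /chi asboolF.
pose near2 x := exists2 p, J2 p & cabs (x - p) < 3 * e.
pose c a b : int := if `[< near2 a >] then chi b - chi a else 0.
have crossing x y : cabs (x - y) < e -> chi x <> chi y ->
    exists p, [/\ J1 p \/ J2 p, cabs (x - p) < 2 * e & cabs (y - p) < 2 * e].
  have main a b : cabs (a - b) < e -> K a -> ~ K b ->
      exists p, [/\ J1 p \/ J2 p, cabs (a - p) < 2 * e & cabs (b - p) < 2 * e].
    move=> ab Ka nKb; have [p [Kp bp pb]] := nearest_is_boundary kK Ka nKb.
    exists p; split; [exact: KJ| |lra].
    by have := cabs_dist b a p; lra.
  move=> xy; have [Kx|nKx] := pselect (K x); have [Ky|nKy] := pselect (K y).
  - by rewrite !chi_in.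
  - by move=> _; exact: main.
  - move=> _; rewrite cabsC in xy.
    by have [p [? ? ?]] := main _ _ xy Ky nKx; exists p.
  - by rewrite !chi_out.
(* Where nearness to J2 changes, no boundary point is close: in J2 it would make
   both points near J2, in J1 it would be at distance less than 6 e from J2. *)
have near2_jump a b d : cabs (a - b) < e -> cabs (b - d) < e ->
    `[< near2 a >] != `[< near2 b >] -> chi b = chi d.
  move=> ab bd; have [[p Jp ap]|na] := asboolP (near2 a);
    have [[p' Jp' bp]|nb] := asboolP (near2 b) => // _;
    apply: contrapT => /(crossing _ _ bd)[q [[Jq|Jq] bq dq]].
  - have := J12 _ _ Jq Jp; have := cabs_dist b q p; have := cabs_dist a b p.
    by rewrite (cabsC q b) (cabsC b a); lra.
  - by apply: nb; exists q => //; lra.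
  - have := J12 _ _ Jq Jp'; have := cabs_dist b q p'.
    by rewrite (cabsC q b); lra.
  - by apply: na; exists q => //; have := cabs_dist b a q; lra.
have cocycle a b d : cabs (a - b) < e -> cabs (b - d) < e -> cabs (a - d) < e ->
    c a b + c b d = c a d.
  move=> ab bd _; rewrite /c; have := near2_jump a b d ab bd.
  case: `[< near2 a >]; case: `[< near2 b >] => /= E.
  - by rewrite addrC subrKA.
  - by rewrite E// addr0.
  - by rewrite E// subrr addr0.
  - by rewrite addr0.
have r40 : 0 <= 4 * r by lra.
have [T TE] := cocycle_primitive e0 r40 cocycle.
have e20 : 0 < e / 2 by lra.
have T_out x y : cabs x <= 4 * r -> cabs y <= 4 * r -> cabs (x - y) < e / 2 ->
    ~ K x -> ~ K y -> T x = T y.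
  move=> xr yr xy nx ny; apply/eqP; rewrite eq_sym -subr_eq0 TE// /c !chi_out//.
  by rewrite subrr if_same.
have T_in x y : cabs x <= 4 * r -> cabs y <= 4 * r -> cabs (x - y) < e / 2 ->
    K x -> K y -> T x = T y.
  move=> xr yr xy nx ny; apply/eqP; rewrite eq_sym -subr_eq0 TE// /c !chi_in//.
  by rewrite subrr if_same.
have nK_r x : r <= cabs x -> ~ K x by move=> rx /Kr; rewrite ltNge rx.
pose t0 := T (3 * r)%:C%C.
have T_far x : 2 * r <= cabs x <= 4 * r -> T x = t0.
  move=> xr; apply: (annulus_locally_constant r0 e20) => //; last first.
    by rewrite cabs_real gtr0_norm; lra.
  by move=> a b /andP[? ?] /andP[? ?] ab; apply: T_out => //; exact: nK_r.
have K_nbhs x : ~ K x -> exists2 d : R, 0 < d & forall y, cabs (x - y) < d -> ~ K y.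
  move=> nKx; have /open_cabsP := closed_openC cK; exact.
(* T is constant far out; the points off K where it differs form a bounded open
   set whose boundary lies in K, and there is no such set. *)
pose S := [set x | [/\ ~ K x, cabs x < 3 * r & T x <> t0]].
have S0 : S = set0.
  apply: full => [|x [] _ /ltW|x []|x clSx nSx] //.
    apply/open_cabsP => x [nKx xr Tx]; have [d d0 dK] := K_nbhs x nKx.
    exists (Num.min (e / 2) (Num.min (3 * r - cabs x) d)).
      by rewrite !lt_min e20 subr_gt0 xr.
    move=> y; rewrite !lt_min => /and3P[xye xyr xyd].
    have yr : cabs y < 3 * r.
      by have := cabsB x (x - y); rewrite subKr; lra.
    split => //; first exact: dK.
    by rewrite -(T_out x y) //; [lra|lra|exact: dK].
  apply: contrapT => nKx.
  have xr : cabs x <= 3 * r by apply: closure_bounded clSx => y [] _ /ltW.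
  have [y [nKy yr Ty] xy] := (closure_cabsP S x).1 clSx _ e20.
  have Tx : T x <> t0 by rewrite (T_out x y)//; lra.
  have [xr'|xr'] := ltrP (cabs x) (3 * r); first exact: nSx.
  by apply: Tx; apply: T_far; lra.
have T_outside x : ~ K x -> cabs x < 3 * r -> T x = t0.
  move=> nKx xr; apply: contrapT => Tx.
  by have : S x by []; rewrite S0.
have boundary_jump x : K x -> ~ interior K x ->
    exists y, [/\ ~ K y, cabs (x - y) < e / 2, cabs x <= 4 * r,
                  cabs y <= 4 * r & T y = t0].
  move=> Kx nix; have xr := Kr _ Kx.
  have m0 : 0 < Num.min (e / 2) r by rewrite lt_min e20.
  have clx : closure (~` K) x by rewrite closure_setC.
  have [y nKy] := (closure_cabsP (~` K) x).1 clx _ m0.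
  rewrite lt_min => /andP[xye xyr].
  have yr : cabs y < 2 * r by have := cabsB x (x - y); rewrite subKr; lra.
  by exists y; split => //; [lra|lra|apply: T_outside => //; lra].
exists [set x | K x /\ T x = t0]; first by move=> x [].
split.
- move=> x Kx nix J1x; split => //.
  have [y [nKy xy xr yr <-]] := boundary_jump x Kx nix.
  apply/eqP; rewrite eq_sym -subr_eq0 TE// /c asboolF// => -[p J2p xp].
  by have := J12 _ _ J1x J2p; have := cabs_ge0 (x - p); lra.
- move=> x Kx nix J2x [_ Tx].
  have [y [nKy xy xr yr Ty]] := boundary_jump x Kx nix.
  have := TE _ _ xr yr xy; rewrite Ty Tx subrr /c asboolT.
    by rewrite (chi_in x Kx) (chi_out y nKy).
  by exists x => //; rewrite cabsxx; lra.
- move=> x y [Kx Tx] Ky nK1y; rewrite leNgt; apply/negP => xy; apply: nK1y.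
  split => //; rewrite -Tx; apply/esym; apply: T_in => //.
    by have := Kr _ Kx; lra.
  by have := Kr _ Ky; lra.
Qed.

End planar.

(** * Isolating a boundary point inside a full compact set *)

Section full_sets.
Context {R : realType}.
Implicit Types (x y z w : R[i]) (K S U V : set R[i]).

(** K has no bounded complementary component, expressed without components so
that the maximum principle applies directly. *)
Definition full K := forall S (M : R),
  open S -> (forall x, S x -> cabs x <= M) ->
  (forall x, S x -> ~ K x) -> (forall x, closure S x -> ~ S x -> K x) ->
  S = set0.

Lemma open_thickening K (e : R) :
  open [set x | exists2 y, K y & cabs (x - y) < e].
Proof.
apply/open_cabsP => x [y Ky xy]; exists (e - cabs (x - y)); first by rewrite subr_gt0.
by move=> w xw; exists y => //; have := cabs_dist x w y; rewrite (cabsC w x); lra.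
Qed.

(** If the farthest point x from z in K1 were interior to K, points slightly
further out would belong to K but not to K1, too close to x. *)
Lemma farthest_in_boundary K K1 z (e : R) :
  compact K -> 0 < e -> K1 `<=` K -> K1 z ->
  (forall x y, K1 x -> K y -> ~ K1 y -> e <= cabs (x - y)) ->
  ~ interior K z ->
  exists x, [/\ K1 x, ~ interior K x &
    forall y, K1 y -> cabs (z - y) <= cabs (z - x)].
Proof.
move=> kK e0 K1K K1z K1e niz.
have cK1 : closed K1.
  have cK : closed K by apply: compact_closed kK; exact: norm_hausdorff.
  move=> x clx; apply: contrapT => nK1x.
  have Kx : K x by apply: cK; exact: closureS clx.
  have [y K1y] := (closure_cabsP K1 x).1 clx e e0.
  by rewrite cabsC ltNge K1e.
have kK1 := subclosed_compact cK1 kK K1K.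
have [|x /set_mem K1x xmax] := compact_EVT_max _ kK1
  (continuous_subspaceT (@continuous_cabsB _ z)); first by exists z.
have {}xmax y : K1 y -> cabs (z - y) <= cabs (z - x).
  by move=> K1y; apply: xmax; exact: mem_set.
exists x; split; [exact: K1x| |exact: xmax].
move=> ix; have [d d0 dK] := (nbhs_cabsP x K).1 ix.
have xz : 0 < cabs (x - z).
  by rewrite cabs_gt0 subr_eq0; apply: contra_not_neq niz => <-.
clear niz ix.
have [m m0 [md me]] : exists2 m : R, 0 < m & m <= d /\ m <= e.
  by exists (Num.min d e); rewrite ?lt_min ?d0// !ge_min !lexx orbT.
pose t := m / (m + cabs (x - z)).
have den : 0 < m + cabs (x - z) by rewrite addr_gt0.
have t0 : 0 < t by rewrite divr_gt0.
have xt : cabs (x - segment x z (- t)) < m.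
  rewrite -{1}(segment0 x z) segment_dist sub0r opprK gtr0_norm//.
  by rewrite /t mulrAC ltr_pdivrMr// ltr_pM2l//; lra.
have Ky : K (segment x z (- t)) by apply: dK; exact: lt_le_trans md.
have [K1y|nK1y] := pselect (K1 (segment x z (- t))); last first.
  by have := K1e _ _ K1x Ky nK1y; rewrite leNgt (lt_le_trans xt).
have := xmax _ K1y.
rewrite -{1}(segment1 x z) segment_dist opprK (cabsC z) gtr0_norm ?addr_gt0//.
by rewrite -[leRHS]mul1r ler_pM2r//; lra.
Qed.

(** The component of z is isolated in the boundary, then the partition of the
boundary is extended to K; the piece K1 around z stays within r/2 of z because
its farthest point is on the boundary, hence in J1. *)
Lemma isolate_in_filled K z (r : R) : compact K -> full K ->
  (closure K `\` interior K) z ->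
  connected_component (closure K `\` interior K) z = [set z] -> 0 < r ->
  exists V U, [/\ open V, open U, V `&` U = set0, K `<=` V `|` U &
    V z /\ forall x, V x -> cabs (z - x) < r].
Proof.
move=> kK fK; set J := _ `\` _ => Jz compz r0.
have cK : closed K by apply: compact_closed kK; exact: norm_hausdorff.
have JE : J = K `&` ~` interior K by rewrite /J -(closure_id K).1.
have cJ : closed J.
  by rewrite JE; apply: closedI => //; apply: open_closedC; exact: open_interior.
have kJ : compact J.
  by apply: subclosed_compact kK _ => //; rewrite JE; exact: subIsetl.
have r20 : 0 < r / 2 by lra.
have [J1 [e e0 [J1J J1z J1r J1e]]] := isolate_component kJ cJ Jz compz r20.
have [M M0 KM] : exists2 M : R, 0 < M & forall x, K x -> cabs x < M.
  have [|x _ xmax] := compact_EVT_max _ kK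
    (continuous_subspaceT (@continuous_cabsB _ 0)).
    by exists z; move: Jz; rewrite JE => -[].
  exists (cabs (0 - x) + 1) => [|y Ky]; first by rewrite ltr_wpDl// cabs_ge0.
  by have := xmax y (mem_set Ky); rewrite sub0r cabsN; lra.
have e60 : 0 < e / 6 by lra.
have J12 x y : J1 x -> (J `\` J1) y -> 6 * (e / 6) <= cabs (x - y).
  by move=> J1x [Jy nJ1y]; have := J1e _ _ J1x Jy nJ1y; lra.
have KJ x : K x -> ~ interior K x -> J1 x \/ (J `\` J1) x.
  move=> Kx nix; have Jx : J x by rewrite JE; exact: (conj Kx nix).
  have [J1x|nJ1x] := pselect (J1 x); first by left; exact: J1x.
  by right; exact: (conj Jx nJ1x).
have [K1 K1K [K1J1 K1J2 K1e]] := filled_separation kK cK e60 M0 KM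
  KJ J12 (fun S => fK S (3 * M)).
have [Kz niz] : K z /\ ~ interior K z by move: Jz; rewrite JE => -[].
have K1z : K1 z := K1J1 _ Kz niz J1z.
have e120 : 0 < e / 6 / 2 by lra.
have [x [K1x nix xmax]] := farthest_in_boundary kK e120 K1K K1z K1e niz.
have zx : cabs (z - x) < r / 2.
  have [J1x|J2x] := KJ _ (K1K _ K1x) nix; first exact: J1r.
  by case: (K1J2 _ (K1K _ K1x) nix J2x).
clear niz nix.
pose h := Num.min (e / 6 / 2 / 2) (r / 2).
have h0 : 0 < h by rewrite lt_min r20 andbT; lra.
have he : h <= e / 6 / 2 / 2 by rewrite ge_min lexx.
have hr : h <= r / 2 by rewrite ge_min lexx orbT.
exists [set x | exists2 y, K1 y & cabs (x - y) < h].
exists [set x | exists2 y, (K `\` K1) y & cabs (x - y) < h].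
split; [exact: open_thickening|exact: open_thickening| | |].
- apply/seteqP; split=> // w [[y K1y wy] [y' [Ky' nK1y'] wy']].
  by have := K1e _ _ K1y Ky' nK1y'; have := cabs_dist w y y'; rewrite (cabsC y w); lra.
- move=> w Kw; have [K1w|nK1w] := pselect (K1 w); [left|right]; exists w => //;
    by rewrite cabsxx.
- split; first by exists z => //; rewrite cabsxx.
  move=> w [y K1y wy]; have := xmax _ K1y; have := cabs_dist y z w.
  by rewrite (cabsC y w); lra.
Qed.

End full_sets.

(** * Polynomial dynamics *)

Section horner_topology.
Context {R : realType}.
Implicit Types (x y z w : R[i]) (A V : set R[i]) (p : {poly R[i]}).

Lemma open_horner_preimage p V : open V -> open [set x | V p.[x]].
Proof.
move=> /open_cabsP oV; apply/open_cabsP => x /oV[e e0 eV].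
have [d d0 dp] := horner_eps_delta p x e0.
by exists d => // y /dp /eV.
Qed.

Lemma closed_horner_le p (m : R) : closed [set x | cabs p.[x] <= m].
Proof.
move=> x /closure_cabsP clx /=; rewrite leNgt; apply/negP => px.
have e0 : 0 < cabs p.[x] - m by rewrite subr_gt0.
have [d d0 dp] := horner_eps_delta p x e0.
have [y /= py /dp xy] := clx _ d0.
by have := cabsD (p.[x] - p.[y]) p.[y]; rewrite subrK; lra.
Qed.

Lemma closure_horner p A V x : (forall y, A y -> V p.[y]) ->
  closure A x -> closure V p.[x].
Proof.
move=> AV /closure_cabsP clx; apply/closure_cabsP => e e0.
have [d d0 dp] := horner_eps_delta p x e0.
by have [y /AV Vy /dp xy] := clx _ d0; exists p.[y].
Qed.

Lemma closure_disjoint_open A V x : open V -> A `&` V = set0 ->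
  closure A x -> ~ V x.
Proof.
move=> oV AV0 clx Vx; have := clx V (open_nbhs_nbhs (conj oV Vx)).
by rewrite AV0 => -[].
Qed.

(** M varies in the induction: for p X + c to exceed M, it is enough that p
exceeds 1 and that |x| exceeds M + |c|. *)
Lemma horner_large p (M : R) : (1 < size p)%N ->
  exists2 r : R, 0 < r & forall x, r <= cabs x -> M <= cabs p.[x].
Proof.
elim/poly_ind: p M => [|p c ih] M; first by rewrite size_poly0.
have [p1 _|p1] := ltnP 1 (size p).
  have [r r0 rp] := ih 1 p1.
  exists (Num.max r (M + cabs c)) => [|x]; first by rewrite lt_max r0.
  rewrite ge_max => /andP[/rp px xM]; rewrite !hornerE.
  have := cabsB (p.[x] * x + c) c; rewrite addrK cabsM.
  have := ler_wpM2r (cabs_ge0 x) px; lra.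
have [a ->] : exists a, p = a%:P by exists p`_0; exact: size1_polyC.
have [->|a0 _] := eqVneq a 0.
  by rewrite mul0r add0r size_polyC; case: (c == 0).
have ca0 : 0 < cabs a by rewrite cabs_gt0.
exists ((`|M| + cabs c + 1) / cabs a) => [|x].
  by rewrite divr_gt0// ltr_wpDl// addr_ge0 ?cabs_ge0.
rewrite ler_pdivrMr// mulrC => xM; rewrite !hornerE.
have := cabsB (a * x + c) c; rewrite addrK cabsM.
by have := ler_norm M; lra.
Qed.

End horner_topology.

Section dynamics.
Context {R : realType}.
Implicit Types (x y z w : R[i]) (A V : set R[i]) (f p : {poly R[i]}).

Definition iter_poly (f : {poly R[i]}) (n : nat) : {poly R[i]} :=
  iter n (fun q => f \Po q) 'X.

Lemma horner_iter_poly f n x : (iter_poly f n).[x] = iter n (horner f) x.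
Proof.
rewrite /iter_poly; elim: n => [|n ih]; first by rewrite hornerX.
by rewrite !iterS horner_comp ih.
Qed.

Lemma size_iter_poly f n : (size (iter_poly f n)).-1 = ((size f).-1 ^ n)%N.
Proof.
rewrite /iter_poly; elim: n => [|n ih]; first by rewrite size_polyX.
by rewrite iterS size_comp_poly ih expnS.
Qed.

Lemma iter_polyD f m n : iter_poly f (m + n) = iter_poly f m \Po iter_poly f n.
Proof.
rewrite /iter_poly; elim: m => [|m ih]; first by rewrite comp_polyX.
by rewrite addSn !iterS ih comp_polyA.
Qed.

(** For f = p X + c with p not constant, |p| >= 3 and |x| >= |c| give
|f(x)| >= 3 |x| - |c| >= 2 |x|. *)
Lemma escape_radius f : (2 < size f)%N ->
  exists2 r : R, 0 < r & forall x, r <= cabs x -> 2 * cabs x <= cabs f.[x].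
Proof.
elim/poly_ind: f => [|p c _]; first by rewrite size_poly0.
move=> sf; have p1 : (1 < size p)%N.
  by move: sf; rewrite size_MXaddC; case: ifP.
have [r r0 rp] := horner_large 3 p1.
exists (Num.max r (cabs c)) => [|x]; first by rewrite lt_max r0.
rewrite ge_max => /andP[/rp px xc]; rewrite !hornerE.
have := cabsB (p.[x] * x + c) c; rewrite addrK cabsM.
by have := ler_wpM2r (cabs_ge0 x) px; lra.
Qed.

Lemma filled_juliaP f x :
  filled_julia f x <-> exists B : R, forall n, cabs (iter n (horner f) x) <= B.
Proof.
split=> [[M [Mr MB]]|[B xB]].
  exists (complex.Re (M + 1)) => n.
  have M1 : (complex.Re (M + 1))%:C%C = M + 1 by apply: RRe_real; rewrite rpredD ?rpred1.
  have := MB (M + 1) _ n I; rewrite ltrDl ltr01 => /(_ isT) /=.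
  by rewrite normE -{1}M1 lecR.
exists B%:C%C; split => [|M BM n _]; first by apply/complex_realP; exists B.
by apply: le_trans (ltW BM); rewrite normE lecR.
Qed.

Lemma exp2_large (B r : R) : 0 < r ->
  exists n0, forall n, (n0 <= n)%N -> B < 2 ^+ n * r.
Proof.
move=> r0; exists (Num.truncn (B / r)).+1 => n nn.
rewrite -ltr_pdivrMr//; apply: lt_le_trans (truncnS_gt _) _.
apply: (@le_trans _ _ n%:R); first by rewrite ler_nat.
by rewrite -natrX ler_nat ltnW// ltn_expl.
Qed.

Lemma exp2_ge1 k : 1 <= 2 ^+ k :> R.
Proof. by rewrite exprn_ege1// ler1n. Qed.

Section escape.
Variables (f : {poly R[i]}) (r : R).
Hypothesis r_gt0 : 0 < r.
Hypothesis escape : forall x, r <= cabs x -> 2 * cabs x <= cabs f.[x].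

Lemma iter_escape k x : r <= cabs x ->
  2 ^+ k * cabs x <= cabs (iter k (horner f) x).
Proof.
move=> rx; elim: k => [|k ih]; first by rewrite expr0 mul1r.
have kx : r <= cabs (iter k (horner f) x).
  by have := ler_wpM2r (cabs_ge0 x) (exp2_ge1 k); lra.
by have := escape kx; rewrite iterS exprS; lra.
Qed.

Lemma iter_escape_lt k x : (0 < k)%N -> r <= cabs x ->
  r < cabs (iter k (horner f) x).
Proof.
move=> k0 rx; apply: lt_le_trans (iter_escape k rx).
have x0 : 0 < cabs x by exact: lt_le_trans rx.
apply: le_lt_trans rx _; rewrite -[ltLHS]mul1r ltr_pM2r//.
by rewrite exprn_egt1 ?ltr1n// -lt0n.
Qed.

Lemma not_filled_escapes x (B : R) : ~ filled_julia f x ->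
  exists n0, forall n, (n0 <= n)%N -> B < cabs (iter n (horner f) x).
Proof.
move=> nKx.
have [m rm] : exists m, r <= cabs (iter m (horner f) x).
  apply: contrapT => nE; apply: nKx; apply/filled_juliaP; exists r => n.
  by rewrite leNgt; apply/negP => rn; apply: nE; exists n; exact: ltW.
have [n0 nB] := exp2_large B r_gt0.
exists (n0 + m)%N => n nn.
have mn : (m <= n)%N by apply: leq_trans nn; rewrite leq_addl.
rewrite -(subnK mn) iterD; apply: lt_le_trans (iter_escape _ rm).
apply: lt_le_trans (nB (n - m)%N _) _; first by rewrite leq_subRL// addnC.
by rewrite ler_wpM2l// exprn_ge0.
Qed.

Lemma filled_julia_lt x n : filled_julia f x -> cabs (iter n (horner f) x) < r.
Proof.
move=> /filled_juliaP[B xB]; rewrite ltNge; apply/negP => rx.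
have [n0 /(_ n0 (leqnn n0)) nB] := exp2_large B r_gt0.
have := le_trans (iter_escape n0 rx) _; rewrite -iterD => /(_ _ (xB _)).
apply/negP; rewrite -ltNge; apply: lt_le_trans nB _.
by rewrite ler_wpM2l// exprn_ge0.
Qed.

Lemma filled_julia_le x :
  filled_julia f x <-> forall n, cabs (iter n (horner f) x) <= r.
Proof.
split=> [Kx n|xr]; first by rewrite ltW// filled_julia_lt.
by apply/filled_juliaP; exists r.
Qed.

(** These compact sets decrease to the filled Julia set, each lying in the
interior of the preceding one. *)
Definition escape_level n := [set x | cabs (iter n (horner f) x) <= r].

Lemma closed_escape_level n : closed (escape_level n).
Proof.
have -> : escape_level n = [set x | cabs (iter_poly f n).[x] <= r].
  by apply/seteqP; split=> x; rewrite /escape_level /= horner_iter_poly.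
exact: closed_horner_le.
Qed.

Lemma escape_levelS n x :
  escape_level n.+1 x -> cabs (iter n (horner f) x) < r.
Proof.
rewrite /escape_level /= leNgt => nx; rewrite ltNge; apply: contra nx => rx.
exact: (@iter_escape_lt 1).
Qed.

Lemma escape_level_decr m n : (m <= n)%N -> escape_level n `<=` escape_level m.
Proof.
elim: n => [|n ih]; first by rewrite leqn0 => /eqP ->.
rewrite leq_eqVlt => /predU1P[-> //|/ih mn] x /escape_levelS /ltW nx.
exact: mn.
Qed.

Lemma closed_filled_julia : closed (filled_julia f).
Proof.
move=> x /closure_cabsP clx; apply/filled_julia_le => n.
apply: closed_escape_level; apply/closure_cabsP => e /clx[y Ky xy].
by exists y => //; exact: (filled_julia_le y).1.
Qed.

Lemma compact_filled_julia : compact (filled_julia f).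
Proof.
apply: (bounded_closed_compactC closed_filled_julia) => x Kx.
exact: (filled_julia_le x).1 Kx 0%N.
Qed.

Lemma escape_level_in_open V : open V -> filled_julia f `<=` V ->
  exists N, escape_level N `<=` V.
Proof.
move=> oV KV; apply: contrapT => nE.
have c0 : compact (escape_level 0).
  exact: (@bounded_closed_compactC _ _ r (closed_escape_level (n := 0))).
have [n|n|n|x [_ Fx]] := @compact_nested _ _ (fun n => escape_level n `&` ~` V) c0.
- by apply: closedI; [exact: closed_escape_level|exact: open_closedC].
- by move=> x [xn nVx]; split => //; exact: escape_level_decr xn.
- apply: contrapT => nx; apply: nE; exists n => x xn; apply: contrapT => nVx.
  by apply: nx; exists x; split => //; exact: escape_level_decr xn.
have : filled_julia f x by apply/filled_julia_le => n; case: (Fx n I).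
by move=> /KV; case: (Fx 0%N I).
Qed.

(** An iterate of f bounded by r on the boundary of S is bounded by r on S,
so S would lie in the filled Julia set. *)
Lemma full_filled_julia : (1 < size f)%N -> full (filled_julia f).
Proof.
move=> f1 S M oS SM SnK Sb; apply/seteqP; split=> // x Sx.
apply: (SnK x Sx); apply/filled_julia_le => n.
rewrite -horner_iter_poly; apply: (maximum_modulus _ oS SM (ltW r_gt0)) => //.
  have : (0 < (size (iter_poly f n)).-1)%N.
    by rewrite size_iter_poly expn_gt0 -subn1 subn_gt0 f1.
  by case: (size _) => [|[]].
move=> y cly nSy; rewrite horner_iter_poly.
exact: (filled_julia_le y).1 (Sb _ cly nSy) n.
Qed.

End escape.

End dynamics.

(** * The multiplier at an isolated periodic point *)

Section multiplier.
Context {R : realType}.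
Implicit Types (x y z w : R[i]) (f g p : {poly R[i]}).

(** The difference quotient of p at z is the value of g nearby, and g is
continuous. *)
Lemma derive1_horner_quotient p g z :
  p - p.[z]%:P = g * ('X - z%:P) -> derive1 (horner p) z = g.[z].
Proof.
move=> pE; rewrite /derive1; apply: cvg_lim; first exact: norm_hausdorff.
move=> U /nbhs_cabsP[e e0 eU].
have [d d0 dg] := horner_eps_delta g z e0.
apply/nbhs_cabsP; exists d => // h; rewrite sub0r cabsN => hd h0.
apply: eU; have -> : h^-1 *: (p.[h + z] - p.[z]) = g.[h + z].
  have : (p - p.[z]%:P).[h + z] = (g * ('X - z%:P)).[h + z] by rewrite pE.
  rewrite !hornerE addrK => ->.
  by rewrite [LHS]mulrC mulfK.
by apply: dg; rewrite opprD addrCA subrr addr0 cabsN.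
Qed.

Variables (f : {poly R[i]}) (r : R).
Hypothesis r_gt0 : 0 < r.
Hypothesis escape : forall x, r <= cabs x -> 2 * cabs x <= cabs f.[x].
Hypothesis f_size : (2 < size f)%N.

Variables (z : R[i]) (n : nat) (g : {poly R[i]}).
Hypothesis n_gt0 : (0 < n)%N.
Hypothesis z_fixed : iter n (horner f) z = z.
Hypothesis gE : iter_poly f n - z%:P = g * ('X - z%:P).

Lemma iter_fixed k : iter (n * k) (horner f) z = z.
Proof. by elim: k => [|k ih]; rewrite ?muln0// mulnS iterD ih z_fixed. Qed.

(** The quotient of f^(nk) - z by X - z, in product form: its zeros are the
points whose orbit under f^n meets a zero of g before time k. *)
Definition orbit_quotient k := \prod_(j < k) (g \Po iter_poly f (n * j)).

Lemma orbit_quotientE k :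
  iter_poly f (n * k) - z%:P = orbit_quotient k * ('X - z%:P).
Proof.
rewrite /orbit_quotient; elim: k => [|k ih].
  by rewrite muln0 big_ord0 mul1r.
rewrite big_ord_recr /= mulrAC -ih [RHS]mulrC mulnS iter_polyD.
have := congr1 (comp_poly (iter_poly f (n * k))) gE.
by rewrite comp_polyB comp_polyM comp_polyB comp_polyC comp_polyX.
Qed.

Lemma orbit_quotient_dist k x :
  cabs (iter (n * k) (horner f) x - z) =
  cabs (orbit_quotient k).[x] * cabs (x - z).
Proof.
have := congr1 (fun p => cabs p.[x]) (orbit_quotientE k).
by rewrite /= hornerD hornerN hornerC horner_iter_poly hornerM hornerXsubC cabsM.
Qed.

Lemma orbit_quotient_prod k x :
  (orbit_quotient k).[x] = \prod_(j < k) g.[iter (n * j) (horner f) x].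
Proof.
rewrite horner_prod; apply: eq_bigr => j _.
by rewrite horner_comp horner_iter_poly.
Qed.

Lemma size_orbit_quotient k : (0 < k)%N -> (1 < size (orbit_quotient k))%N.
Proof.
move=> k0.
have s1 : (1 < (size (iter_poly f (n * k))).-1)%N.
  have f1 : (1 < (size f).-1)%N by rewrite -ltnS (ltn_predK f_size).
  rewrite size_iter_poly; apply: (leq_trans f1).
  by rewrite -{1}[(size f).-1]expn1 leq_pexp2l ?(ltnW f1)// muln_gt0 n_gt0.
have s2 : (2 < size (iter_poly f (n * k) - z%:P)%R)%N.
  have s3 : (2 < size (iter_poly f (n * k)))%N by case: (size _) s1.
  rewrite size_polyDl// size_polyN; apply: leq_ltn_trans (ltnW s3).
  by rewrite size_polyC leq_b1.
move: s2; rewrite orbit_quotientE.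
have [->|q0] := eqVneq (orbit_quotient k) 0; first by rewrite mul0r size_poly0.
by rewrite size_Mmonic ?monicXsubC// size_XsubC addn2.
Qed.

(** With multiplier 0, f^n does not increase the distance to z near z, so the
orbits of nearby points stay bounded. *)
Lemma quotient_neq0 : ~ interior (filled_julia f) z -> g.[z] != 0.
Proof.
move=> niK; apply/eqP => gz; apply: niK.
have [d d0 dg] := horner_eps_delta g z ltr01.
apply/nbhs_cabsP; exists d => // x zx; apply: contrapT => nKx.
have orbit k : cabs (iter (n * k) (horner f) x - z) <= cabs (z - x).
  elim: k => [|k ih]; first by rewrite muln0 cabsC.
  rewrite mulnS iterD; set y := iter (n * k) _ x in ih *.
  have := congr1 (fun p => cabs p.[y]) gE.
  rewrite /= hornerD hornerN hornerC horner_iter_poly hornerM hornerXsubC cabsM => ->.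
  apply: le_trans (ih); rewrite ler_piMl ?cabs_ge0//.
  have /dg : cabs (z - y) < d by rewrite cabsC; exact: le_lt_trans ih zx.
  by rewrite gz sub0r cabsN => /ltW.
have [m /(_ (n * m)%N)] := not_filled_escapes r_gt0 escape (cabs z + d) nKx.
rewrite leq_pmull// => /(_ isT); apply/negP; rewrite -leNgt.
by have := cabsD (iter (n * m) (horner f) x - z) z; rewrite subrK; have := orbit m; lra.
Qed.

Lemma iter_in_nbhs_open V k : open V ->
  open [set x | forall j, (j <= k)%N -> V (iter (n * j) (horner f) x)].
Proof.
move=> oV; elim: k => [|k ih].
  have -> : [set x | forall j, (j <= 0)%N -> V (iter (n * j) (horner f) x)] = V.
    apply/seteqP; split=> x /=; first by move=> /(_ 0%N (leqnn _)); rewrite muln0.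
    by move=> Vx j; rewrite leqn0 => /eqP ->; rewrite muln0.
  exact: oV.
have oP := @open_horner_preimage _ (iter_poly f (n * k.+1)) _ oV.
rewrite (_ : mkset _ = [set x | forall j, (j <= k)%N -> V (iter (n * j) (horner f) x)]
   `&` [set x | V (iter_poly f (n * k.+1)).[x]]); first exact: openI.
apply/seteqP; split=> x /=.
  move=> Vx; split; last by rewrite horner_iter_poly; exact: Vx.
  by move=> j jk; apply: Vx; exact: leqW.
move=> [Vx Vk] j; rewrite leq_eqVlt => /predU1P[->|]; last exact: Vx.
by move: Vk; rewrite horner_iter_poly.
Qed.

(** The minimum modulus principle for [orbit_quotient k] on the set S of points
near z whose first k iterates under f^n stay in V. *)
Lemma isolated_point_repelling :
  g.[z] != 0 ->
  (forall e : R, 0 < e -> exists V U, [/\ open V, open U, V `&` U = set0,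
     filled_julia f `<=` V `|` U & V z /\ forall x, V x -> cabs (z - x) < e]) ->
  filled_julia f z ->
  1 < cabs g.[z].
Proof.
move=> gz0 iso Kz.
have gz : 0 < cabs g.[z] by rewrite cabs_gt0.
have [d0 d0_gt0 dg] := horner_eps_delta g z gz.
have g_neq0 x : cabs (z - x) < d0 -> g.[x] != 0.
  by move=> /dg; apply: contraTneq => ->; rewrite subr0 ltxx.
have [V0 [U0 [oV0 oU0 VU0 KVU0 [V0z V0d]]]] := iso d0 d0_gt0.
have [N NVU0] := escape_level_in_open r_gt0 escape (openU oV0 oU0) KVU0.
(* Cutting with the level r makes every boundary point of V escape: its N-th
   iterate has modulus at least r. *)
pose V := V0 `&` [set x | cabs (iter N (horner f) x) < r].
have oV : open V.
  apply: openI => //.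
  have -> : [set x | cabs (iter N (horner f) x) < r] =
      [set x | [set y | cabs y < r] (iter_poly f N).[x]].
    by apply/seteqP; split=> x /=; rewrite horner_iter_poly.
  apply: open_horner_preimage; apply/open_cabsP => x /= xr.
  exists (r - cabs x) => [|y xy]; first by rewrite subr_gt0.
  by have := cabsB x (x - y); rewrite subKr; lra.
have Vz : V z by split=> //; exact: (filled_julia_lt r_gt0 escape).
have clV x : closure V x -> escape_level f r N x.
  move=> clx; apply: closed_escape_level.
  by apply: closureS clx => y [_ /ltW].
have bdV x : closure V x -> ~ V x -> r <= cabs (iter N (horner f) x).
  move=> clx nVx; rewrite leNgt; apply/negP => xr; apply: nVx; split => //.
  have [//|U0x] := NVU0 _ (clV _ clx).
  have clx0 : closure V0 x by apply: closureS clx => y [].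
  by have := closure_disjoint_open oU0 VU0 clx0.
have [d d_gt0 dV] := (open_cabsP V).1 oV z Vz.
have d20 : 0 < d / 2 by lra.
have [V1 [U1 [oV1 oU1 VU1 KVU1 [V1z V1d]]]] := iso (d / 2) d20.
have [N1 N1VU1] := escape_level_in_open r_gt0 escape (openU oV1 oU1) KVU1.
pose k := N1.+1.
pose W := [set x | forall j, (j <= k)%N -> V (iter (n * j) (horner f) x)].
have oW : open W by exact: iter_in_nbhs_open.
pose S := W `&` V1.
have oS : open S by exact: openI.
have Sz : S z by split => // j _; rewrite iter_fixed.
have SM x : S x -> cabs x <= cabs z + d / 2.
  by move=> [_ /V1d zx]; have := cabsB z (z - x); rewrite subKr; lra.
have Q0 x : S x -> (orbit_quotient k).[x] != 0.
  move=> [Wx _]; rewrite orbit_quotient_prod; apply/prodf_neq0 => j _.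
  apply/g_neq0/V0d; by case: (Wx j (ltnW (ltn_ord j))).
have Qb x : closure S x -> ~ S x -> 2 <= cabs (orbit_quotient k).[x].
  move=> clx nSx.
  have clVj j : (j <= k)%N -> closure V (iter (n * j) (horner f) x).
    move=> jk; rewrite -horner_iter_poly; apply: closure_horner clx => y [Wy _].
    by rewrite horner_iter_poly; exact: Wy.
  have V1x : V1 x.
    have : escape_level f r N1 x.
      apply: (escape_level_decr r_gt0 escape (n := N + n * k)).
        by apply: leq_trans (leq_addl _ _); apply: leq_trans (leq_pmull _ n_gt0).
      by rewrite /escape_level /= iterD; exact: clV (clVj k (leqnn k)).
    move=> /N1VU1[//|U1x].
    have clx1 : closure V1 x by apply: closureS clx => y [].
    by have := closure_disjoint_open oU1 VU1 clx1.
  have [j jk nVj] : exists2 j, (j <= k)%N & ~ V (iter (n * j) (horner f) x).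
    apply: contrapT => nE; apply: nSx; split => // j jk.
    by apply: contrapT => nVj; apply: nE; exists j.
  have jr := bdV _ (clVj _ jk) nVj.
  (* A point of the boundary of V leaves the closure of V at the next step, so
     the orbit of x can meet that boundary only at time k. *)
have jE : j = k.
    apply/eqP; rewrite eqn_leq jk leqNgt; apply/negP => ltjk.
    have := clV _ (clVj _ ltjk); rewrite /escape_level /= -iterD mulnS addnCA !iterD.
    by rewrite leNgt (iter_escape_lt r_gt0 escape n_gt0 jr).
  have zk : d <= cabs (iter (n * k) (horner f) x - z).
    by rewrite leNgt cabsC; apply/negP => /dV; rewrite -jE.
  have := orbit_quotient_dist k x; have := V1d _ V1x; rewrite (cabsC z x) => xd E.
  rewrite leNgt; apply/negP => Q2.
  have := cabs_ge0 (x - z); have := cabs_ge0 (orbit_quotient k).[x]; nra.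
have sQ : (1 < size (orbit_quotient k))%N by exact: size_orbit_quotient.
have := minimum_modulus sQ oS SM Q0 Qb Sz.
rewrite orbit_quotient_prod (eq_bigr (fun _ => g.[z])) => [|j _]; last by rewrite iter_fixed.
rewrite prodr_const card_ord cabsX => zk; rewrite ltNge; apply/negP => z1.
by have := exprn_ile1 k (ltW gz) z1; lra.
Qed.

End multiplier.

Unset Implicit Arguments.

Theorem corollary1p7 (R : realType) (f : {poly R[i]}) (D : nat)
    (degf : size f = D.+1) (D_ge2 : (2 <= D)%N)
    (disconnJ : ~ connected (julia f))
    (z : R[i]) (n : nat) (Jz : julia f z) (zn : has_period (horner f) n z)
    (compz : connected_component (julia f) z = [set z]) :
  1 < `| derive1 (iter n (horner f)) z |.
Proof.
have f_size : (2 < size f)%N by rewrite degf.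
have [r r_gt0 escape] := escape_radius f_size.
have [n_gt0 z_fixed _] := zn.
have kK := compact_filled_julia r_gt0 escape.
have fK := full_filled_julia r_gt0 escape (ltnW f_size).
have zn_root : root (iter_poly f n - z%:P) z.
  by rewrite /root hornerD hornerN hornerC horner_iter_poly z_fixed subrr.
have /factor_theorem[g gE] := zn_root.
have Kz : filled_julia f z.
  by have [clz _] := Jz; apply: (closed_filled_julia r_gt0 escape).
have -> : iter n (horner f) = horner (iter_poly f n).
  by apply/funext => x; rewrite horner_iter_poly.
have znE : (iter_poly f n).[z] = z by rewrite horner_iter_poly.
rewrite (@derive1_horner_quotient _ _ g) ?znE// normE -[1]/(1%:C%C) ltcR.
apply: (isolated_point_repelling r_gt0 escape f_size n_gt0 z_fixed gE) => //.
  by have [_ niK] := Jz; exact: (quotient_neq0 r_gt0 escape n_gt0 gE niK).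
by move=> e e0; exact: isolate_in_filled kK fK Jz compz e0.
Qed.
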